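(* Let $C\subset\mathbb{Q}\cap(0,1)$ be a finite set of rational numbers. Then the intersection $\bigcap_{c\in C}\mathcal{H}(c)$ is an uncountable set of positive Hausdorff dimension.
   Context: $\mathbb{N}$ denotes the positive integers and $\langle x\rangle=x-[x]$ the fractional part of $x\in\mathbb{R}$. For $0<c<1$, $$\mathcal{H}(c)=\Big\{\alpha\in\mathbb{R}\;:\;\mathrm{card}\{1\le k\le n : \langle k\alpha\rangle<c\}\ge cn\ \text{ for all } n\in\mathbb{N}\Big\}.$$ *)

(* Defs.v *)
From HB Require Import structures.
From mathcomp Require Import all_boot all_order all_algebra archimedean.
From mathcomp Require Import all_classical all_reals all_analysis.

Set Implicit Arguments.
Unset Strict Implicit.
Unset Printing Implicit Defensive.

Import Order.TTheory GRing.Theory Num.Theory.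
Import numFieldNormedType.Exports.

Local Open Scope classical_set_scope.
Local Open Scope ring_scope.

Definition frac (R : realType) (x : R) : R := x - (Num.floor x)%:~R.

Definition heavy (R : realType) (c : R) : set R :=
  [set alpha : R | forall n : nat, (0 < n)%N ->
    c * n%:R <=
      #|[pred k : 'I_n.+1 | (1 <= k)%N && (frac (k%:R * alpha) < c)]|%:R].

(* [diam set0 = -oo]: the empty set is treated separately in [diam_pow]. *)
Definition diam (R : realType) (U : set R) : \bar R :=
  ereal_sup [set `|p.1 - p.2|%:E | p in U `*` U].

(* Since [powR 0 0 = 1], a nonempty set has weight 1 when [s = 0], so that the
   0-dimensional measure is the counting measure. *)
Definition diam_pow (R : realType) (s : R) (U : set R) : \bar R :=
  if U == set0 then 0%E else poweR (diam U) s.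

(* Sequences of sets account for finite covers as well, by padding with
   [set0]. *)
Definition hausdorff_content (R : realType) (s delta : R) (A : set R) :
    \bar R :=
  ereal_inf [set (\sum_(0 <= i <oo) diam_pow s (F i))%E |
    F in [set F : nat -> set R |
      (forall i, (diam (F i) <= delta%:E)%E) /\ A `<=` \bigcup_i F i]].

(* The limit as [delta] tends to 0 is a supremum, since [hausdorff_content] is
   nonincreasing in [delta]. *)
Definition hausdorff_measure (R : realType) (s : R) (A : set R) : \bar R :=
  ereal_sup [set hausdorff_content s delta A | delta in [set d : R | 0 < d]].

Definition hausdorff_dim (R : realType) (A : set R) : \bar R :=
  ereal_inf [set s%:E |
    s in [set s : R | 0 <= s /\ hausdorff_measure s A = 0%E]].

(* Main.v *)
Require Import Defs.
From HB Require Import structures.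
From mathcomp Require Import all_boot all_order all_algebra archimedean.
From mathcomp Require Import ring lra.
From mathcomp Require Import all_classical all_reals all_analysis.
(* [frac] is to be the fractional part, not the pair of a formal fraction. *)
Import Defs.

Set Implicit Arguments.
Unset Strict Implicit.
Unset Printing Implicit Defensive.

Import Order.TTheory GRing.Theory Num.Theory.
Import numFieldNormedType.Exports.

(**
A number [alpha] is heavy for [c] when the orbit [k * alpha] mod 1 visits [[0, c)]
at least as often as expected up to every time [n]. A visit at time [k] is a
lattice point [(k, j)] of the strip [j <= k * alpha < j + c], and the proof
counts these points row by row, that is, for fixed [j] ([hits_rows]).

Let [m] be a common denominator of the elements of [C]. If
[alpha = 1 / (m + 1 / (b + gam))] with [b] a positive integer, row [j] of
[alpha] is the interval of length [c / alpha = c * m + c / (b + gam)] starting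
at [j / alpha = j * m + j / (b + gam)]. As [j * m] and [c * m] are integers, the
count in this row is [c * m] plus the count in row [j] for the slope [b + gam],
and the latter slope has the same visits as [gam]. So each of the first [J]
rows contributes the [c * m] points expected of [m] steps, and what remains is
the count for [gam] up to a smaller time ([hits_mobius]). By induction on time,
[alpha] is heavy for all [c] in [C] at once as soon as it can be renormalized in
this way forever ([coding_hits]), that is, when its continued fraction is
[[0; m, b_1, m, b_2, ...]].

It remains to see that there are many such numbers. Letting each [b_i] be 1 or 3
according to the binary digits of [t] in [[0, 1)] gives a map [coding m] from
[[0, 1)] into the intersection. It is built from two contractions with disjoint
images whose contraction rates are bounded below, so that distances between
codes control the distances of the parameters:
[|t - t'| <= 2 * |coding m t - coding m t'| ^ s]
with [s > 0] ([coding_holder]). This makes [coding m] injective, whence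
uncountability, and it turns every cover of the intersection into a cover of
[[0, 1)] by intervals, so that countable subadditivity of Lebesgue measure bounds
the Hausdorff measures of small exponent away from 0
([hausdorff_dim_ge_of_holder]).
*)

Local Open Scope classical_set_scope.
Local Open Scope ring_scope.

(** * Counting visits by rows of lattice points *)

Lemma count_nat_itv (R : realType) (a b : R) N : 0 <= a -> a <= b -> b <= N%:R ->
  \sum_(k < N) ((a <= k%:R) && (k%:R < b))%R%:R =
  (Num.ceil b - Num.ceil a)%:~R :> R.
Proof.
move=> a0 ab bN.
have below (c : R) : 0 <= c -> c <= N%:R ->
    \sum_(k < N) (k%:R < c)%R%:R = (Num.ceil c)%:~R :> R.
  move=> c0 cN.
  have [M cM] : exists M : nat, Num.ceil c = M%:Z.
    have /gez0_abs <- : 0 <= Num.ceil c; last by eexists.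
    by rewrite ceil_ge0 (lt_le_trans _ c0) ?ltrN10.
  have MN : (M <= N)%N by rewrite -lez_nat -cM ceil_le_int.
  have lt_cE (k : nat) : (k%:R < c) = (k < M)%N.
    by rewrite -ltz_nat -cM ceil_gt_int.
  under eq_bigr do rewrite lt_cE.
  rewrite cM -natr_sum -big_mkcond /=.
  by rewrite -(big_ord_widen N (fun=> 1%N) MN) sum1_card card_ord.
rewrite intrB -(below b) ?(le_trans a0 ab)// -(below a) ?(le_trans ab bN)// -sumrB.
apply: eq_bigr => k _; have [ka|ak] := ltP k%:R a; last by rewrite subr0.
by rewrite (lt_le_trans ka ab) subrr.
Qed.

(** The only [j] that can contribute is the integer part of [y]. *)
Lemma frac_ltE (R : realType) (c y : R) J :
  0 < c -> c <= 1 -> 0 <= y -> y < J%:R ->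
  (frac y < c)%R%:R = \sum_(j < J) ((j%:R <= y) && (y < j%:R + c))%R%:R :> R.
Proof.
move=> c0 c1 y0 yJ.
have fl : Num.floor y = (Num.truncn y)%:Z.
  by rewrite truncn_floor y0 gez0_abs ?floor_ge0.
have /andP[ly yl] := truncn_itv y0.
have tJ : (Num.truncn y < J)%N by rewrite -(ltr_nat R) (le_lt_trans ly).
rewrite (bigD1 (Ordinal tJ)) //= big1 => [|i /eqP iJ].
  by rewrite ly addr0 /= /frac fl ltrBlDl.
case: (leP i%:R y) => //= iy; case: ltP => // yi.
exfalso; apply: iJ; apply/val_inj => /=; apply/eqP.
rewrite eqn_leq truncn_ge_nat// iy -ltnS -(ltr_nat R) (le_lt_trans ly)//.
by rewrite (lt_le_trans yi)// -natr1 lerD2l.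
Qed.

(** The index [k = 0] is included: it is always a hit when [0 < c], which shifts
    the heaviness inequality by one but makes the rows of [hits_rows] start at
    the row [0] with no exception. *)
Definition hits (R : realType) (th c : R) (n : nat) : R :=
  \sum_(k < n) (frac (k%:R * th) < c)%R%:R.

(** Double counting of the lattice points [(k, j)] of the strip
    [j <= k * th < j + c]. Summing over [j] first counts the hits; summing over
    [k] first counts the integers of the intervals [j / th, (j + c) / th). The
    two bounds on [J] say that the cutoff at [k < n] does not split a row. *)
Lemma hits_rows (R : realType) (th c : R) (n J : nat) :
  0 < th -> 0 < c -> c <= 1 ->
  (n.-1)%:R * th < J%:R -> J%:R - 1 + c <= n%:R * th ->
  hits th c n =
  \sum_(j < J) (Num.ceil ((j%:R + c) / th) - Num.ceil (j%:R / th))%:~R.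
Proof.
move=> th0 c0 c1 nJ Jn.
rewrite /hits; transitivity (\sum_(k < n) \sum_(j < J)
    ((j%:R <= k%:R * th) && (k%:R * th < j%:R + c))%R%:R : R).
  apply: eq_bigr => k _; apply: frac_ltE => //; first by rewrite mulr_ge0// ltW.
  rewrite (le_lt_trans _ nJ)// ler_pM2r// ler_nat.
  by case: n k {nJ Jn} => [[]|n k]//=; rewrite -ltnS.
rewrite exchange_big /=; apply: eq_bigr => j _.
rewrite -(@count_nat_itv _ _ _ n).
- by apply: eq_bigr => k _; rewrite ler_pdivrMr// ltr_pdivlMr.
- by rewrite divr_ge0// ltW.
- by rewrite ler_pM2r ?invr_gt0// lerDl ltW.
- rewrite ler_pdivrMr// (le_trans _ Jn)// lerD2r -lerBlDr opprK.
  by rewrite natr1 ler_nat.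
Qed.

Lemma fracDn (R : realType) (x : R) (b : nat) : frac (b%:R + x) = frac x.
Proof.
by rewrite /frac floorDzr ?natr_int// -[b%:R]/(b%:Z%:~R) intrKfloor intrD; ring.
Qed.

(** The extra hit at [k = 0] accounts for the summand [1]. *)
Lemma hits_heavy (R : realType) (c alpha : R) :
  0 < c -> (forall n, 1 + c * n%:R <= hits alpha c n.+1) -> heavy c alpha.
Proof.
move=> c0 hn n n0; rewrite -(lerD2l 1) (le_trans (hn n))// /hits.
rewrite -sum1_card natr_sum [in leRHS]big_mkcond /= [leRHS]addrC.
rewrite !big_ord_recl /= mul0r add0r [leRHS]addrC lerD//.
  by rewrite lern1 leq_b1.
rewrite ler_sum// => i _; rewrite unfold_in /=.
by case: ifP.
Qed.

(** * Renormalization by two continued fraction steps *)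

(** For [x <> 0] this is [1 / (m + 1 / x)], so [mobius m (b + gam)] prepends the
    partial quotients [m] and [b] to a continued fraction with value [gam]. *)
Definition mobius (R : realType) (m : nat) (x : R) : R := x / (m%:R * x + 1).

(** The renormalization step. Put [x = b + gam], so that [1 / alpha = m + 1 / x].
    Row [j] of the strip of [alpha] is the interval from [j / alpha] to
    [(j + c) / alpha], which is the row [j] of the strip of [x] moved by the
    integer [j * m] and lengthened by the integer [c * m = p]. Hence each row
    of [alpha] has exactly [p] more points than the same row of [x], and the
    hits of [x] are those of [gam], since [b] is an integer. Heaviness of [alpha]
    at a non-hit [n] follows from heaviness of [gam] at some [t < n]. *)
Lemma hits_mobius (R : realType) (m p n b : nat) (c gam : R) :
  0 < c -> c <= 1 -> c * m%:R = p%:R -> (0 < m)%N -> (0 < b)%N -> 0 <= gam ->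
  let alpha := mobius m (b%:R + gam) in
  (forall k, (k < n)%N -> 1 + c * k%:R <= hits gam c k.+1) ->
  c <= frac (n%:R * alpha) -> 1 + c * n%:R <= hits alpha c n.+1.
Proof.
move=> c0 c1 cm m0 b0 g0; set x := b%:R + gam => alpha IH nonhit.
have x1 : 1 <= x by rewrite ler_wpDr// ler1n.
have x0 : 0 < x by rewrite (lt_le_trans _ x1).
have m1 : 1 <= m%:R :> R by rewrite ler1n.
have al0 : 0 < alpha by rewrite divr_gt0// addr_gt0// mulr_gt0// ltr0n.
have alV : alpha^-1 = m%:R + x^-1 by rewrite /alpha /mobius; field; nra.
have al1 : alpha <= 1 by rewrite -invf_ge1// alV ler_wpDr// invr_ge0 ltW.
have na0 : 0 <= n%:R * alpha by rewrite mulr_ge0// ltW.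
(* [n] is not a hit, so rows [0, ..., J - 1] lie entirely below [n] and all
   later rows above. *)
pose J := (Num.truncn (n%:R * alpha)).+1.
have /andP[ln nJ] := truncn_itv na0.
have JE : J%:R = (Num.truncn (n%:R * alpha))%:R + 1 :> R by rewrite natr1.
have nonhitJ : J%:R - 1 + c <= n%:R * alpha.
  rewrite JE addrK -lerBrDl; apply: le_trans nonhit _.
  by rewrite /frac -[Num.floor _]gez0_abs ?floor_ge0// truncn_floor na0.
(* [t] is the last integer strictly below [J / x]: the terms [k <= t] of the
   orbit of [x] are exactly those that fill the same [J] rows. *)
have Jx0 : 0 < J%:R / x by rewrite divr_gt0.
have [t tE] : exists t : nat, Num.ceil (J%:R / x) = t.+1%:Z.
  have : 0 < Num.ceil (J%:R / x) by rewrite ceil_gt0.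
  by case: (Num.ceil _) => // -[|t]// _; exists t.
have /andP[tJ Jt] : t%:R < J%:R / x <= t.+1%:R.
  by have := ceil_itv (J%:R / x); rewrite tE -addn1 PoszD addrK -PoszD.
have tn : (t < n)%N.
  apply: (@leq_trans J).
    by rewrite -(ltr_nat R) (lt_le_trans tJ)// ler_pdivrMr// ler_peMr.
  rewrite /J -(ltr_nat R); apply: (@lt_le_trans _ _ (n%:R * alpha));
    last by rewrite ler_piMr.
  by apply: lt_le_trans nonhitJ; rewrite JE addrK ltrDl.
rewrite (@hits_rows _ _ _ _ J)//; last first.
  by rewrite (le_trans nonhitJ)// ler_pM2r// ler_nat.
have row (j : 'I_J) :
    (Num.ceil ((j%:R + c) / alpha) - Num.ceil (j%:R / alpha))%:~R =
    p%:R + (Num.ceil ((j%:R + c) / x) - Num.ceil (j%:R / x))%:~R :> R.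
  have -> : (j%:R + c) / alpha = (j * m + p)%:Z%:~R + (j%:R + c) / x.
    by rewrite alV -pmulrn natrD natrM -cm; ring.
  have -> : j%:R / alpha = (j * m)%:Z%:~R + j%:R / x.
    by rewrite alV -pmulrn natrM; ring.
  rewrite !ceilDzr ?intr_int// !intrKceil !intrB !intrD !PoszD !intrD -!pmulrn.
  ring.
under eq_bigr do rewrite row.
rewrite big_split /= sumr_const card_ord -(@hits_rows _ _ _ t.+1 J)//; first last.
- by rewrite -ler_pdivrMr// (le_trans _ Jt)// ler_pM2r ?invr_gt0//; lra.
- by rewrite /= -ltr_pdivlMr.
have -> : hits x c t.+1 = hits gam c t.+1.
  by apply: eq_bigr => k _; rewrite /x mulrDr -natrM fracDn.
have := IH _ tn.
rewrite -[_ *+ J]mulr_natr -cm.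
(* The total number of hits is [p * J] plus the hits of [gam] up to [t], and
   [p = c * m], so it suffices that [n <= J * m + t]. *)
have : n%:R < J%:R * m%:R + t.+1%:R :> R.
  have : n%:R * alpha < J%:R by [].
  rewrite -ltr_pdivlMr// alV mulrDr => h; rewrite (lt_le_trans h)// lerD2l.
  exact: Jt.
have -> : J%:R * m%:R + t.+1%:R = (J * m + t.+1)%:R :> R by rewrite natrD natrM.
rewrite ltr_nat addnS ltnS -(ler_nat R) natrD natrM.
nra.
Qed.

Lemma mobius_le (R : realType) m (x y : R) :
  0 <= x -> x <= y -> mobius m x <= mobius m y.
Proof.
move=> x0 xy; have m0 : 0 <= m%:R :> R by rewrite ler0n.
rewrite /mobius ler_pdivrMr; last by nra.
rewrite mulrAC ler_pdivlMr; nra.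
Qed.

Lemma mobius_ge0 (R : realType) m (x : R) : 0 <= x -> 0 <= mobius m x.
Proof. by move=> x0; rewrite divr_ge0// addr_ge0// mulr_ge0. Qed.

Lemma mobius_le1 (R : realType) m (x : R) :
  (0 < m)%N -> 0 <= x -> mobius m x <= 1.
Proof.
move=> m0 x0; have m1 : 1 <= m%:R :> R by rewrite ler1n.
by rewrite /mobius ler_pdivrMr; nra.
Qed.

(** The difference quotient of [mobius m] is
    [1 / ((m * x + 1) * (m * y + 1))]. *)
Lemma mobius_dist (R : realType) m (x y : R) : 0 <= x <= 4 -> 0 <= y <= 4 ->
  `|x - y| / (4 * m%:R + 1) ^+ 2 <= `|mobius m x - mobius m y|.
Proof.
move=> x4 y4; have m0 : 0 <= m%:R :> R by rewrite ler0n.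
have x0 : 0 < m%:R * x + 1 by nra.
have y0 : 0 < m%:R * y + 1 by nra.
have -> : mobius m x - mobius m y =
    (x - y) / ((m%:R * x + 1) * (m%:R * y + 1)).
  by rewrite /mobius; field; rewrite !gt_eqF.
rewrite normrM normfV [in leRHS](ger0_norm (ltW (mulr_gt0 x0 y0))).
have M0 : 0 < 4 * m%:R + 1 :> R by lra.
rewrite ler_wpM2l// lef_pV2 ?posrE ?exprn_gt0// ?mulr_gt0//.
by rewrite expr2 ler_pM// ?(ltW x0) ?(ltW y0)//; nra.
Qed.

(** * The Cantor set of renormalizable numbers *)

Definition digit (R : realType) (t : R) : nat := (2^-1 <= t)%R.
Definition doubling (R : realType) (t : R) : R := 2 * t - (digit t)%:R.

Lemma doubling_itv (R : realType) (t : R) : 0 <= t < 1 -> 0 <= doubling t < 1.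
Proof. by rewrite /doubling /digit; case: (leP 2^-1 t) => /= *; lra. Qed.

(** Iterates of the two contractions [mobius m (1 + _)] and [mobius m (3 + _)],
    chosen by the binary digits of [t]. Partial quotients 1 and 3, rather than
    1 and 2, keep the two images of [[0, 1]] disjoint. *)
Fixpoint coding_approx (R : realType) (m n : nat) (t : R) : R :=
  if n is n'.+1 then
    mobius m ((digit t).*2.+1%:R + coding_approx m n' (doubling t)) else 0.

Definition coding (R : realType) (m : nat) (t : R) : R :=
  limn (coding_approx m ^~ t).

Lemma coding_approx_itv (R : realType) m n (t : R) : (0 < m)%N ->
  0 <= coding_approx m n t <= 1.
Proof.
move=> m0; elim: n t => [|n IH] t /=; first by rewrite lexx ler01.
have /andP[h0 _] := IH (doubling t).
by rewrite mobius_ge0 ?mobius_le1// addr_ge0.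
Qed.

(** Both contractions are increasing and the iteration starts at the least
    element of [[0, 1]], so the approximations increase. *)
Lemma coding_approx_cvg (R : realType) m (t : R) : (0 < m)%N ->
  coding_approx m n t @[n --> \oo] --> coding m t.
Proof.
move=> m0; apply: nondecreasing_is_cvgn.
  apply/nondecreasing_seqP => n; elim: n t => [|n IH] t.
    by case/andP: (coding_approx_itv 1 t m0).
  apply: mobius_le; last by rewrite lerD2l; exact: IH.
  by case/andP: (coding_approx_itv n (doubling t) m0) => *; rewrite addr_ge0.
by exists 1 => _ [n _ <-]; case/andP: (coding_approx_itv n t m0).
Qed.

Lemma coding_itv (R : realType) m (t : R) : (0 < m)%N ->
  0 <= coding m t <= 1.
Proof.
move=> m0; have c := coding_approx_cvg (t := t) m0.
have cc : cvgn (coding_approx m ^~ t) by apply/cvg_ex; exists (coding m t).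
apply/andP; split.
  by apply: limr_ge => //; near=> n; case/andP: (coding_approx_itv n t m0).
by apply: limr_le => //; near=> n; case/andP: (coding_approx_itv n t m0).
Unshelve. all: by end_near. Qed.

Lemma codingE (R : realType) m (t : R) : (0 < m)%N ->
  coding m t = mobius m ((digit t).*2.+1%:R + coding m (doubling t)).
Proof.
move=> m0; have /andP[g0 _] := coding_itv (doubling t) m0.
have c : coding_approx m n.+1 t @[n --> \oo] --> coding m t.
  by rewrite (@cvg_shiftS R (coding_approx m ^~ t)); exact: coding_approx_cvg.
apply: (cvg_unique _ c) => //=.
have cD : (digit t).*2.+1%:R + coding_approx m n (doubling t) @[n --> \oo]
    --> (digit t).*2.+1%:R + coding m (doubling t).
  by apply: cvgD; [exact: cvg_cst | exact: coding_approx_cvg].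
apply: cvgM; first exact: cD.
apply: cvgV; first by rewrite gt_eqF// ltr_pwDr// mulr_ge0// addr_ge0.
by apply: cvgD; [apply: cvgM; [exact: cvg_cst | exact: cD] | exact: cvg_cst].
Qed.

(** Strong induction on [n], simultaneously for all [t] because renormalizing
    shifts the code. At a hit the count grows by [1 >= c], so only the non-hits
    need [hits_mobius]. *)
Lemma coding_hits (R : realType) (m p : nat) (c t : R) n :
  (0 < m)%N -> 0 < c -> c <= 1 -> c * m%:R = p%:R ->
  1 + c * n%:R <= hits (coding m t) c n.+1.
Proof.
move=> m0 c0 c1 cm; elim/ltn_ind: n t => n IH t.
have [lt_c|] := ltP (frac (n%:R * coding m t)) c; last first.
  have /andP[g0 _] := coding_itv (doubling t) m0.
  by rewrite codingE//; apply: (hits_mobius c0 c1 cm) => // k kn; exact: IH.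
case: n IH lt_c => [|n] IH lt_c; rewrite /hits big_ord_recr /= lt_c.
  by rewrite big_ord0 mulr0 addr0 add0r.
have := IH n (ltnSn n) t; rewrite /hits => h.
by rewrite -natr1 mulrDr mulr1 addrA lerD.
Qed.

(** If the first binary digits of [t] and [t'] agree, doubling doubles their
    distance while undoing a contraction of rate at least [2 ^- N]; if they
    differ, the two images are separated. *)
Lemma coding_separation (R : realType) m N n (t t' : R) : (0 < m)%N ->
  (4 * m%:R + 1) ^+ 2 <= 2 ^+ N :> R -> 0 <= t < 1 -> 0 <= t' < 1 ->
  2 ^- n < `|t - t'| -> 2 ^- (N * n) <= `|coding m t - coding m t'|.
Proof.
move=> m0 mN; elim: n t t' => [|n IH] t t' t01 t'01 tt'.
  by move: tt'; rewrite expr0 invr1 ltNge ler_norml; lra.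
rewrite (codingE t m0) (codingE t' m0).
have /andP[u0 u1] := coding_itv (doubling t) m0.
have /andP[v0 v1] := coding_itv (doubling t') m0.
set u := coding m _ in u0 u1 *; set v := coding m _ in v0 v1 *.
have itv4 (s w : R) : 0 <= w -> w <= 1 -> 0 <= (digit s).*2.+1%:R + w <= 4.
  move=> w0 w1; rewrite addr_ge0//= (_ : 4 = 3 + 1); last by rewrite -natr1.
  by rewrite lerD// ler_nat /digit; case: (2^-1 <= s)%R.
apply: le_trans (mobius_dist _ (itv4 _ _ u0 u1) (itv4 _ _ v0 v1)).
have M0 : 0 < (4 * m%:R + 1) ^+ 2 :> R.
  by rewrite exprn_gt0// ltr_wpDl// mulr_ge0.
suff : 2 ^- (N * n) <= `|(digit t).*2.+1%:R + u - ((digit t').*2.+1%:R + v)|.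
  rewrite mulnS exprD invfM mulrC => h.
  by rewrite ler_pM// lef_pV2 ?posrE// exprn_gt0.
have [dd|dd] := eqVneq (digit t) (digit t').
  rewrite dd opprD addrACA subrr add0r; apply: IH; rewrite ?doubling_itv//.
  rewrite /doubling dd opprB addrA subrK -mulrBr normrM ger0_norm//.
  by move: tt'; rewrite exprS invfM; set a := _ ^- n; lra.
(* Distinct digits: the integer parts 1 and 3 differ by 2, the fractional
   tails by at most 1. *)
apply: (@le_trans _ _ 1).
  by rewrite invf_le1 ?exprn_gt0// exprn_ege1// ler1n.
have d1 : true.*2.+1%:R = 3 :> R by [].
have d0 : false.*2.+1%:R = 1 :> R by [].
move: dd; rewrite ler_normr /digit.
case: (2^-1 <= t)%R; case: (2^-1 <= t')%R => // _; rewrite d0 d1; apply/orP;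
  [left|right]; lra.
Qed.

(** Take the least [n] with [2 ^- n < |t - t'|] in [coding_separation]. *)
Lemma coding_holder (R : realType) m N (t t' : R) : (0 < m)%N -> (0 < N)%N ->
  (4 * m%:R + 1) ^+ 2 <= 2 ^+ N :> R -> 0 <= t < 1 -> 0 <= t' < 1 ->
  `|t - t'| <= 2 * `|coding m t - coding m t'| `^ (N%:R^-1).
Proof.
move=> m0 N0 mN t01 t'01.
have [->|tt'] := eqVneq t t'.
  by rewrite subrr normr0 mulr_ge0// powR_ge0.
have d0 : 0 < `|t - t'| by rewrite normr_gt0 subr_eq0.
have exn : exists n, 2 ^- n < `|t - t'|.
  have [n nd] : exists n : nat, `|t - t'|^-1 < n%:R.
    exists (Num.truncn `|t - t'|^-1).+1.
    by case/andP: (truncn_itv (ltW (etrans (invr_gt0 _) d0))).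
  exists n; rewrite invf_plt ?posrE ?exprn_gt0// (lt_le_trans nd)//.
  by rewrite -natrX ler_nat ltnW// ltn_expl.
have := ex_minnP exn; move=> [[|n] nd nmin].
  by move: nd; rewrite expr0 invr1 ltNge ler_norml; lra.
have dn : `|t - t'| <= 2 ^- n.
  by rewrite leNgt; apply/negP => /nmin; rewrite ltnn.
have a0 k : 0 <= 2 ^- k :> R by rewrite invr_ge0 exprn_ge0.
have /(@ge0_ler_powR _ N%:R^-1) := coding_separation m0 mN t01 t'01 nd.
rewrite !nnegrE normr_ge0 a0 invr_ge0 ler0n => /(_ isT isT isT).
rewrite mulnC exprM -exprVn -powR_mulrn// -powRrM mulfV ?pnatr_eq0 -?lt0n//.
rewrite powRr1// exprS invfM.
by move: dn; set a := 2 ^- n => dn; lra.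
Qed.

(** * Images of the unit interval under inverse Hoelder maps *)

Lemma diam_ub (R : realType) (U : set R) x y :
  U x -> U y -> (`|x - y|%:E <= diam U)%E.
Proof. by move=> Ux Uy; apply: ereal_sup_ubound; exists (x, y). Qed.

Lemma diam_pow_ge0 (R : realType) (s : R) (U : set R) : (0 <= diam_pow s U)%E.
Proof. by rewrite /diam_pow; case: ifP => // _; exact: poweR_ge0. Qed.

(** An interval of radius [K * diam U ^ s0] around any point of the preimage.
    The hypothesis [diam U <= 1] allows the exponent to be lowered from [s0]
    to [s]. *)
Lemma holder_preimage_cover (R : realType) (E : set R) (g : R -> R)
    (K s0 s : R) (U : set R) :
  0 < K -> 0 < s0 -> 0 <= s -> s <= s0 ->
  (forall t t', E t -> E t' -> `|t - t'| <= K * `|g t - g t'| `^ s0) ->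
  (diam U <= 1)%E ->
  exists B, [/\ measurable B, E `&` g @^-1` U `<=` B
    & (lebesgue_measure B <= (2 * K)%:E * diam_pow s U)%E].
Proof.
move=> K0 s00 s_ge0 ss0 gK U1.
have [->|/set0P[t [Et Ut]]] := eqVneq (E `&` g @^-1` U) set0.
  exists set0; split => //.
  by rewrite measure0 mule_ge0 ?diam_pow_ge0// lee_fin mulr_ge0// ltW.
have dU0 : (0 <= diam U)%E.
  by rewrite (le_trans _ (@diam_ub _ U (g t) (g t) Ut Ut))// lee_fin.
have [d dE] : exists d, diam U = d%:E.
  by move: U1 dU0; case: (diam U) => // d _ _; exists d.
move: U1 dU0; rewrite dE !lee_fin => d1 d0.
have UN0 : (U == set0) = false by apply/negbTE/set0P; exists (g t).
exists (`[t - K * d `^ s0, t + K * d `^ s0]%classic); split => //.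
- move=> t' [Et' Ut'] /=; rewrite in_itv /= -ler_distlC distrC.
  apply: (le_trans (gK _ _ Et' Et)); rewrite ler_pM2l//.
  apply: ge0_ler_powR; rewrite ?nnegrE// ?(ltW s00)//.
  by rewrite -lee_fin -dE; exact: diam_ub.
- rewrite /diam_pow UN0 dE poweR_EFin lebesgue_measure_itv /=.
  have pow_le : d `^ s0 <= d `^ s.
    move: d0; rewrite le_eqVlt => /predU1P[<-|d0]; last first.
      by rewrite /powR gt_eqF// ler_expR; have := ln_le0 d1; nra.
    by rewrite powR0 ?gt_eqF// powR_ge0.
  case: ifPn => _; last by rewrite -EFinM lee_fin !mulr_ge0 ?powR_ge0// ltW.
  rewrite -EFinD -EFinM lee_fin.
  by have := powR_ge0 d s; nra.
Qed.

(** The inverse of [g] is Hoelder of exponent [s0] and maps onto the unit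
    interval, so a cover of [A] by sets of diameter at most 1 yields a cover of
    [[0, 1)] by intervals of total length at most [2 * K] times the
    [s]-dimensional weight of the cover; this weight is thus bounded below. *)
Lemma hausdorff_dim_ge_of_holder (R : realType) (A : set R) (g : R -> R)
    (K s0 : R) :
  0 < K -> 0 < s0 -> (forall t, 0 <= t < 1 -> A (g t)) ->
  (forall t t', 0 <= t < 1 -> 0 <= t' < 1 ->
    `|t - t'| <= K * `|g t - g t'| `^ s0) ->
  (s0%:E <= hausdorff_dim A)%E.
Proof.
move=> K0 s00 gA gK; apply: le_ereal_inf_tmp => _ [s [s_ge0 HsA] <-].
rewrite lee_fin leNgt; apply/negP => ss0.
have : ((2 * K)^-1%:E <= hausdorff_measure s A)%E.
  apply: (@le_trans _ _ (hausdorff_content s 1 A)); last first.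
    by apply: ereal_sup_ubound; exists 1 => /=.
  apply: le_ereal_inf_tmp => _ [F [F1 AF] <-].
  have /choice[B BP] : forall i, exists B : set R,
      [/\ measurable B, `[0, 1[ `&` g @^-1` F i `<=` B
      & (lebesgue_measure B <= (2 * K)%:E * diam_pow s (F i))%E].
    move=> i; apply: (@holder_preimage_cover R _ g K s0 s) => //; exact: ltW.
  have : (lebesgue_measure `[0%R, 1%R[%classic <=
          \sum_(0 <= i <oo) lebesgue_measure (B i))%E.
    apply: measure_sigma_subadditive => //; first by move=> i; case: (BP i).
    move=> t t01; have /AF[i _ Fi] : A (g t).
      by apply: gA; rewrite /= in_itv in t01.
    by exists i => //; case: (BP i) => _ + _; apply.
  rewrite lebesgue_measure_itv /= lte_fin ltr01 oppr0 adde0 => le1.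
  have : (1 <= (2 * K)%:E * \sum_(0 <= i <oo) diam_pow s (F i))%E.
    rewrite -nneseriesZl => [|i _]; last exact: diam_pow_ge0.
    apply: (le_trans le1); apply: lee_nneseries => // i _.
    by case: (BP i).
  by move=> le2; rewrite -[X in (X <= _)%E]mule1 lee_pdivrMl ?mulr_gt0.
by rewrite HsA lee_fin leNgt invr_gt0 mulr_gt0.
Qed.

(** The bound makes [g] injective on [[0, 1)]. *)
Lemma uncountable_of_holder (R : realType) (A : set R) (g : R -> R)
    (K s0 : R) :
  0 < s0 -> (forall t, 0 <= t < 1 -> A (g t)) ->
  (forall t t', 0 <= t < 1 -> 0 <= t' < 1 ->
    `|t - t'| <= K * `|g t - g t'| `^ s0) ->
  ~ countable A.
Proof.
move=> s00 gA gK cA.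
have : countable `[0 : R, 1 : R[%classic.
  have g_inj : {in `[0 : R, 1 : R[%classic &, injective g}.
    move=> t t'; rewrite !inE /= !in_itv /= => t01 t'01 gt.
    have := gK _ _ t01 t'01.
    by rewrite gt subrr normr0 powR0 ?gt_eqF// mulr0 normr_le0 subr_eq0 => /eqP.
  rewrite -(eq_countable (inj_card_eq g_inj)).
  apply: sub_countable cA; apply: subset_card_le.
  by move=> _ [t + <-]; rewrite /= in_itv; exact: gA.
move=> /countable_lebesgue_measure0; rewrite lebesgue_measure_itv /= lte_fin.
by rewrite ltr01 oppr0 adde0 => /eqP; rewrite eqe oner_eq0.
Qed.

(** * Heavy numbers for finitely many rational lengths *)

Lemma common_denominator (C : set rat) : finite_set C ->
  exists2 m : nat, (0 < m)%N &
    forall c, C c -> exists z : int, c * m%:R = z%:~R.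
Proof.
move=> /finite_seqP[s ->]; elim: s => [|c s [m m0 IH]].
  by exists 1%N.
exists (m * `|denq c|)%N; first by rewrite muln_gt0 m0 absz_gt0 denq_neq0.
have dE : `|denq c|%N%:R = (denq c)%:~R :> rat.
  by rewrite pmulrn gez0_abs ?denq_ge0.
move=> x /=; rewrite inE natrM => /predU1P[->|/IH[z zE]].
  by exists (numq c * m%:Z); rewrite dE mulrCA -numqE intrM mulrC.
by exists (z * denq c); rewrite mulrA zE dE intrM.
Qed.

Theorem corollary3 (R : realType) (C : set rat)
    (finC : finite_set C) (C01 : forall c : rat, C c -> 0 < c < 1) :
  ~ countable (\bigcap_(c in C) heavy (ratr c : R)) /\
  (0 < hausdorff_dim (\bigcap_(c in C) heavy (ratr c : R)))%E.
Proof.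
have [m m0 Cm] := common_denominator finC.
(* [4 * m + 1 <= 2 ^ (4 * m + 1)] gives the bound on the contraction rate. *)
pose N := (2 * (4 * m + 1))%N.
have N0 : (0 < N)%N by rewrite /N addn1.
have mN : (4 * m%:R + 1) ^+ 2 <= 2 ^+ N :> R.
  rewrite /N mulnC exprM ler_pXn2r ?nnegrE ?addr_ge0 ?mulr_ge0 ?exprn_ge0//.
  by rewrite -natrM natr1 -natrX ler_nat addn1 ltnW// ltn_expl.
have codingH (t : R) : 0 <= t < 1 ->
    (\bigcap_(c in C) heavy (ratr c : R)) (coding m t).
  move=> _ c Cc; have /andP[c0 c1] := C01 _ Cc; have [z zE] := Cm _ Cc.
  have z0 : 0 <= z by rewrite -(ler0z rat) -zE mulr_ge0// ltW.
  apply: hits_heavy; first by rewrite ltr0q.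
  have rc1 : ratr c <= 1 :> R by rewrite -(rmorph1 (@ratr R)) ler_rat ltW.
  have rcm : ratr c * m%:R = `|z|%N%:R :> R.
    by rewrite -(ratr_nat R m) -rmorphM /= zE ratr_int -[in LHS](gez0_abs z0).
  by move=> n; apply: (coding_hits _ _ m0 _ rc1 rcm); rewrite ltr0q.
have s0 : 0 < N%:R^-1 :> R by rewrite invr_gt0 ltr0n.
have holder (t t' : R) := @coding_holder R m N t t' m0 N0 mN.
split; first exact: uncountable_of_holder s0 codingH holder.
apply: (@lt_le_trans _ _ (N%:R^-1 : R)%:E); first by rewrite lte_fin.
exact: hausdorff_dim_ge_of_holder (ltr0n _ 2) s0 codingH holder.
Qed.
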